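(* Let $X$ be a nonempty set and let $e:X\to X$ be an idempotent map, i.e. $e\circ e=e$. Suppose that $X$ is equipped with a family of bijections $\{\alpha_i:X\to X\}_{i\in I}$ such that: (i) (Transitivity) for all $x,y\in X$ there exists $i\in I$ with $\alpha_i(x)=y$; (ii) (Coequalization) for all $i\in I$, one has $e\circ\alpha_i=e$. Then $e$ is constant. Equivalently, the fixed-point object $\mathrm{Fix}(e)=\mathrm{Eq}(e,\mathrm{id}_X)$ is a singleton.
   Context: $\mathrm{Eq}(e,\mathrm{id}_X)$ is the equalizer in $\mathbf{Set}$, i.e. the set $\{x\in X\mid e(x)=x\}$. The index set $I$ is arbitrary, and the family is not assumed to be closed under composition or inverses. *)

(* Defs.v *)
From mathcomp Require Export all_boot.
From mathcomp Require Export boolp classical_sets functions.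

Set Implicit Arguments.
Unset Strict Implicit.
Unset Printing Implicit Defensive.

Local Open Scope classical_set_scope.

Definition equalizer (X Y : Type) (f g : X -> Y) : set X :=
  [set x | f x = g x].

Definition Fix (X : Type) (e : X -> X) : set X := equalizer e id.

Definition singleton (X : Type) (A : set X) : Prop :=
  exists a : X, A = [set a].

Definition constant_fun (X Y : Type) (f : X -> Y) : Prop :=
  exists c : Y, f =1 cst c.

(* Main.v *)
Require Import Defs.

(** Transitivity writes any point [y] as [alpha i x], and coequalization then
    gives [e y = e (alpha i x) = e x], so [e] takes a single value [c]. The
    fixed points of a constant map with value [c] reduce to [c] itself, and
    [e c = c] because [c] is the only available value. *)

Lemma coequalized_transitive_eq (X Y I : Type) (f : X -> Y)
    (alpha : I -> X -> X) :
    (forall x y : X, exists i : I, alpha i x = y) ->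
    (forall i : I, f \o alpha i =1 f) ->
  forall x y : X, f x = f y.
Proof. by move=> tr coeq x y; have [i <-] := tr x y; exact/esym/coeq. Qed.

Lemma Fix_cst (X : Type) (e : X -> X) (c : X) :
  e =1 cst c -> Fix e = [set c]%classic.
Proof.
move=> ec; apply/seteqP; split=> [x <-|_ ->]; first exact: ec.
exact: ec.
Qed.

Theorem lemma6p1 (X I : Type) (e : X -> X) (alpha : I -> X -> X)
    (X_nonempty : inhabited X)
    (e_idem : idempotent_fun e)
    (alpha_bij : forall i : I, bijective (alpha i))
    (alpha_trans : forall x y : X, exists i : I, alpha i x = y)
    (alpha_coeq : forall i : I, e \o alpha i =1 e) :
  constant_fun e /\ singleton (Fix e).
Proof.
case: X_nonempty => x0.
have ec : e =1 cst (e x0).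
  by move=> x; exact: coequalized_transitive_eq alpha_trans alpha_coeq x x0.
by split; exists (e x0); last exact: Fix_cst.
Qed.
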